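(* Let $1<p,q<\infty$ with $\frac1p+\frac1q=1$, suppose $E(|w|^p)^{1/p}E(|u|^q)^{1/q}<\infty$ a.e. $\mu$, let $J=1+E(|w|^p)E(|u|^q)^{p/q}$ and let $\nu$ be the measure $d\nu=J\,d\mu$. Then $S(J)=\Omega$, where $S(J)=\{t: J(t)\neq0\}$, and (i) $L^p(\nu)\subseteq\mathcal{D}(M_wEM_u)$; (ii) $\overline{L^p(\nu)}^{\|\cdot\|_\mu}=\overline{\mathcal{D}(M_wEM_u)}^{\|\cdot\|_\mu}=L^p(\mu)$, where the closures are taken in the norm of $L^p(\mu)$.
   Context: $(\Omega,\Sigma,\mu)$ is a $\sigma$-finite measure space and $\mathcal{A}\subseteq\Sigma$ is a $\sigma$-subalgebra such that $(\Omega,\mathcal{A},\mu)$ is also $\sigma$-finite. $L^p(\Sigma)=L^p(\mu)=L^p(\Omega,\Sigma,\mu)$ and $L^p(\nu)=L^p(\Omega,\Sigma,\nu)$ (complex-valued functions). Comparisons between functions or sets hold up to $\mu$-null sets. $E=E^{\mathcal{A}}$ is the conditional expectation with respect to $\mathcal{A}$: for $f\ge0$ $\Sigma$-measurable (then $E(f)$ may take values in $[0,\infty]$) or $f\in L^p(\Sigma)$, $E(f)$ is the unique $\mathcal{A}$-measurable function with $\int_A f\,d\mu=\int_A E(f)\,d\mu$ for all $A\in\mathcal{A}$ for which the integrals exist. For a general complex-valued $\Sigma$-measurable $f$, $E(f)$ is understood to be defined when $E(|f|)<\infty$ a.e. (by linearity from nonnegative functions). The functions $u,w:\Omega\to\mathbb{C}$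 are $\Sigma$-measurable and conditionable, i.e. $E(u)$ and $E(w)$ are defined. The weighted conditional type (WCT) operator $M_wEM_u$ in $L^p(\mu)$ is $f\mapsto wE(uf)$ with domain $\mathcal{D}(M_wEM_u)=\{f\in L^p(\mu): wE(uf)\in L^p(\mu)\}$ (which includes the requirement that $E(uf)$ is defined).
   Formalization: The condition E(|w|^p)^{1/p}E(|u|^q)^{1/q}<∞ a.e. is read as excluding 0·∞, so both factors are finite a.e.; with 0·∞=0, (i) fails, e.g. for trivial 𝒜, an atomless probability μ, w=0 and u in L^1 but not in L^q. *)

(* Defs.v *)
From HB Require Import structures.
From mathcomp Require Import all_boot all_order all_algebra.
From mathcomp Require Import complex.
From mathcomp Require Import all_classical all_reals all_analysis measurable_realfun.
Set Implicit Arguments.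
Unset Strict Implicit.
Unset Printing Implicit Defensive.
Import Order.TTheory GRing.Theory Num.Theory.
Import numFieldNormedType.Exports.
Local Open Scope classical_set_scope.
Local Open Scope ring_scope.
Local Open Scope ereal_scope.

Section SubSigmaAlgebra.
Context {d : measure_display} {T : measurableType d} {R : realType}.
Variable mu : {measure set T -> \bar R}.
Variable A : set (set T).

(* When [A] is a sigma-algebra, the measurable sets of [g_sigma_algebraType A]
   (the carrier [T] with the sigma-algebra generated by [A]) are exactly the
   members of [A]. *)

Definition sub_sigma_algebra_of : Prop :=
  sigma_algebra [set: T] A /\ A `<=` (@measurable d T).

Definition sigma_finite_on : Prop :=
  @sigma_finite _ (g_sigma_algebraType A) R [set: T] mu.

Definition A_measurable (g : T -> \bar R) : Prop :=
  @measurable_fun _ _ (g_sigma_algebraType A) (\bar R) [set: T] g.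

Definition is_cond_exp (f g : T -> \bar R) : Prop :=
  [/\ A_measurable g,
      forall x, 0 <= g x &
      forall B, A B -> \int[mu]_(x in B) f x = \int[mu]_(x in B) g x].

(* For [f >= 0] measurable a version exists and is unique up to [mu]-null sets;
   [cond_exp f] is some everywhere [[0, +oo]]-valued version. *)
Definition cond_exp (f : T -> \bar R) : T -> \bar R :=
  xget (cst 0) [set g | is_cond_exp f g].

End SubSigmaAlgebra.

Section ComplexFunctions.
Context {d : measure_display} {T : measurableType d} {R : realType}.

(* Borel measurability for [R[i]] identified with R^2 *)
Definition cmeasurable (f : T -> R[i]) : Prop :=
  measurable_fun [set: T] (fun x => complex.Re (f x)) /\
  measurable_fun [set: T] (fun x => complex.Im (f x)).

Definition cabs (f : T -> R[i]) (x : T) : \bar R :=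
  (Normc.normc (f x))%:E.

Definition cLp (mu : {measure set T -> \bar R}) (p : R) : set (T -> R[i]) :=
  [set f | cmeasurable f /\ 'N[mu]_p%:E[cabs f] < +oo].

Definition cLp_closure (mu : {measure set T -> \bar R}) (p : R)
    (S : set (T -> R[i])) : set (T -> R[i]) :=
  [set f | cLp mu p f /\
    forall e : R, (0 < e)%R ->
      exists2 g, S g & 'N[mu]_p%:E[cabs (fun x => f x - g x)%R] < e%:E].

Variables (mu : {measure set T -> \bar R}) (A : set (set T)).

Definition conditionable (f : T -> R[i]) : Prop :=
  cmeasurable f /\ {ae mu, forall x, cond_exp mu A (cabs f) x < +oo}.

Definition cond_expR (f : T -> R) (x : T) : R :=
  (fine (cond_exp mu A ((EFin \o f)^\+)%E x)
   - fine (cond_exp mu A ((EFin \o f)^\-)%E x))%R.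

(* Only meaningful for [conditionable f]; then the four nonnegative conditional
   expectations involved are a.e. finite. *)
Definition cond_expC (f : T -> R[i]) (x : T) : R[i] :=
  Complex (cond_expR (fun y => complex.Re (f y)) x) (cond_expR (fun y => complex.Im (f y)) x).

Definition wct (w u f : T -> R[i]) (x : T) : R[i] :=
  (w x * cond_expC (fun y => u y * f y) x)%R.

Definition wct_domain (p : R) (w u : T -> R[i]) : set (T -> R[i]) :=
  [set f | [/\ cLp mu p f, conditionable (fun x => u x * f x)%R &
               cLp mu p (wct w u f)]].

(* E(|f|^r) *)
Definition cond_moment (r : R) (f : T -> R[i]) : T -> \bar R :=
  cond_exp mu A (fun x => cabs f x `^ r).

(* [0 * +oo = 0] in [\bar R]; [*?] is used alongside [* < +oo] to say that a
   product is determinate as well as finite. *)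
Definition wct_J (p q : R) (w u : T -> R[i]) (x : T) : \bar R :=
  1 + cond_moment p w x * cond_moment q u x `^ (p / q).

End ComplexFunctions.

(* Main.v *)
Require Import Defs.
From HB Require Import structures.
From mathcomp Require Import all_boot all_order all_algebra.
From mathcomp Require Import complex.
From mathcomp Require Import all_classical all_reals all_analysis measurable_realfun.
From mathcomp Require Import ring lra.
Import Order.TTheory GRing.Theory Num.Theory.
Import numFieldNormedType.Exports.
Local Open Scope classical_set_scope.
Local Open Scope ring_scope.
Local Open Scope ereal_scope.
Set Implicit Arguments.
Unset Strict Implicit.
Unset Printing Implicit Defensive.

(** The point is that [nu] controls both [f] and [w E(u f)] in p-th mean.
    Conditional Hoelder gives [E|u f| <= E(|u|^q)^(1/q) E(|f|^p)^(1/p)] almost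
    everywhere, and [|E(u f)| <= 2 E|u f|].  Raise to the power [p], multiply by
    [|w|^p] and integrate.  The factor [E(|u|^q)^(p/q) E(|f|^p)] is measurable
    for the subalgebra, so under the integral [|w|^p] may be replaced by
    [E(|w|^p)]; then [E(|u|^q)^(p/q) E(|w|^p)] is measurable for the subalgebra,
    so [E(|f|^p)] may be replaced by [|f|^p] (both times [cond_exp_mul]).  Hence
    [integral_wct_le]:
      int |w E(u f)|^p dmu <= 2^p int |f|^p J dmu = 2^p int |f|^p dnu,
    which together with [J >= 1] is the inclusion of [L^p(nu)] in the domain.
    Constants are harmless since only finiteness of the integral matters; the 2
    comes from bounding real and imaginary parts separately.

    For density, the hypothesis on the moments forces both of them to be finite
    almost everywhere, hence [J] too ([poweR_mul_lty]).  If [f] is in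
    [L^p(mu)], its truncation to [{J <= n}] lies in [L^p(nu)], because there
    [dnu <= n dmu], and by dominated convergence it tends to [f] in [L^p(mu)]
    ([cLp_density_approx]).  The domain lies between [L^p(nu)] and [L^p(mu)], so
    it is dense as well.

    Conditional expectations of finite nonnegative functions are built from
    Radon-Nikodym derivatives on the subalgebra ([ex_cond_exp]); almost
    everywhere inequalities between them come from comparing integrals over the
    sets of the subalgebra ([ae_le_integral]).  Conditional Hoelder is Young's
    inequality [|u f| <= (t|u|)^q/q + (|f|/t)^p/p], conditioned for each positive
    rational [t], and then optimised in [t] pointwise. *)

(** * Integrals against test functions *)

(** Multiplication by [c = +oo] is discontinuous at 0; the bound [a n <= b]
    saves the case [b = 0], where it forces all [a n] to vanish. *)
Lemma ge0_cvgeMr (R : realType) (a : nat -> R) (b c : \bar R) :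
  (forall n, 0 <= a n)%R -> (forall n, (a n)%:E <= b) ->
  (a n)%:E @[n --> \oo] --> b -> 0 <= c ->
  (a n)%:E * c @[n --> \oo] --> b * c.
Proof.
move=> a0 ab ab_cvg c0; have [cfin|] := boolP (c \is a fin_num).
  exact: cvgeZr.
rewrite ge0_fin_numE// -leNgt leye_eq => /eqP ->.
have b0 : 0 <= b by rewrite (le_trans _ (ab 0%N))// lee_fin.
move: b0; rewrite le_eqVlt => /predU1P[b0|b0].
  rewrite -b0 mul0e; apply: cvg_near_cst; apply: nearW => n.
  have := ab n; rewrite -b0 lee_fin => an0.
  by have /eqP -> : a n == 0%R; [rewrite eq_le an0 a0|rewrite mul0e].
rewrite gt0_muley//; apply: cvg_near_cst.
near=> n; rewrite gt0_muley//.
by near: n; exact: (ab_cvg _ (open_ereal_gt' b0)).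
Unshelve. all: by end_near. Qed.

Section integral_transfer.
Import HBNNSimple.
Context d d' (T : measurableType d) (T' : measurableType d') (R : realType).
Variables (mu : {measure set T -> \bar R}) (phi : T -> T').
Hypothesis mphi : measurable_fun setT phi.
Variable f : T -> \bar R.
Hypotheses (mf : measurable_fun setT f) (f0 : forall x, 0 <= f x).

Lemma integral_indic_comp_mul (B : set T') : measurable B ->
  \int[mu]_x ((\1_B (phi x))%:E * f x) = \int[mu]_(x in phi @^-1` B) f x.
Proof.
move=> mB; rewrite [RHS]integral_mkcond; apply: eq_integral => x _.
by rewrite epatch_indic/= muleC.
Qed.

Lemma integral_nnsfun_comp_mul (h : {nnsfun T' >-> R}) :
  \int[mu]_x ((h (phi x))%:E * f x) =
  \sum_(r \in range h) (r%:E * \int[mu]_(x in phi @^-1` (h @^-1` [set r])) f x).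
Proof.
transitivity (\int[mu]_x (\sum_(r \in range h)
    (r * \1_(h @^-1` [set r]) (phi x))%:E * f x)).
  apply: eq_integral => x _; rewrite -ge0_mule_fsuml => [|r].
    by rewrite fsumEFin // -fimfunE.
  exact: nnfun_muleindic_ge0.
rewrite ge0_integral_fsum//; last 2 first.
- move=> r; apply: emeasurable_funM => //; apply/measurable_EFinP.
  by apply: measurable_funM => //; apply: measurableT_comp.
- by move=> r x _; rewrite mule_ge0// nnfun_muleindic_ge0.
apply: eq_fsbigr => r; rewrite inE => -[t _ <-].
rewrite -integral_indic_comp_mul// -ge0_integralZl ?lee_fin//.
- by apply: eq_integral => x _; rewrite EFinM muleA.
- apply: emeasurable_funM => //; apply/measurable_EFinP.
  by apply: measurableT_comp.
- by move=> x _; rewrite mule_ge0.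
Qed.

Lemma integral_comp_mul_lim (H : T' -> \bar R) (mH : measurable_fun setT H) :
  (forall y, 0 <= H y) ->
  \int[mu]_x (H (phi x) * f x) =
  limn (fun n => \int[mu]_x
    ((nnsfun_approx measurableT mH n (phi x))%:E * f x)).
Proof.
move=> H0; have le_H n y : (nnsfun_approx measurableT mH n y)%:E <= H y.
  by rewrite nnsfun_approxE; apply: le_approx.
rewrite -monotone_convergence//.
- apply: eq_integral => x _; apply/esym/cvg_lim => //.
  by apply: ge0_cvgeMr => //; exact: cvg_nnsfun_approx.
- move=> n; apply: emeasurable_funM => //; apply/measurable_EFinP.
  by apply: measurableT_comp.
- by move=> n x _; rewrite mule_ge0// lee_fin.
- move=> x _ m n mn; rewrite lee_wpmul2r// lee_fin.
  exact/lefP/nd_nnsfun_approx.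
Qed.

End integral_transfer.

Section compare_integrals.
Import HBNNSimple.

(** Allowing two spaces and two maps covers both the averaging property of
    conditional expectation ([T'] is the space with the smaller sigma-algebra
    and both maps are the identity) and integration against a measure with a
    density ([f1] is then the constant 1). *)
Lemma eq_integral_comp_mul d1 d2 d' (T1 : measurableType d1)
    (T2 : measurableType d2) (T' : measurableType d') (R : realType)
    (mu1 : {measure set T1 -> \bar R}) (mu2 : {measure set T2 -> \bar R})
    (phi1 : T1 -> T') (phi2 : T2 -> T') (f1 : T1 -> \bar R) (f2 : T2 -> \bar R)
    (H : T' -> \bar R) :
  measurable_fun setT phi1 -> measurable_fun setT phi2 ->
  measurable_fun setT f1 -> measurable_fun setT f2 ->
  (forall x, 0 <= f1 x) -> (forall x, 0 <= f2 x) ->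
  (forall B, measurable B -> \int[mu1]_(x in phi1 @^-1` B) f1 x =
                             \int[mu2]_(x in phi2 @^-1` B) f2 x) ->
  measurable_fun setT H -> (forall y, 0 <= H y) ->
  \int[mu1]_x (H (phi1 x) * f1 x) = \int[mu2]_x (H (phi2 x) * f2 x).
Proof.
move=> mphi1 mphi2 mf1 mf2 f10 f20 f12 mH H0.
rewrite !(integral_comp_mul_lim _ _ _ _ mH)//; congr (limn _).
apply/funext => n; rewrite !integral_nnsfun_comp_mul//.
by apply: eq_fsbigr => r _; rewrite f12.
Qed.

End compare_integrals.

(** * The measure induced on a sigma-subalgebra *)

Section sub_sigma_algebra.
Context d (T : measurableType d) (R : realType).
Variables (mu : {measure set T -> \bar R}) (A : set (set T)).
Hypothesis hA : sub_sigma_algebra_of A.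
Local Notation TA := (g_sigma_algebraType A).

Lemma sub_sigma_measurableE : @measurable _ TA = A.
Proof. exact: (sigma_algebra_id hA.1). Qed.

Lemma measurable_sub_sigma_id : measurable_fun [set: T] (idfun : T -> TA).
Proof.
by move=> _ B; rewrite sub_sigma_measurableE setTI; exact: hA.2.
Qed.

Lemma measurable_A_measurable (g : T -> \bar R) :
  A_measurable A g -> measurable_fun [set: T] g.
Proof.
move=> mg _ B mB; rewrite setTI; apply: hA.2.
by rewrite -sub_sigma_measurableE -[X in measurable X]setTI; exact: mg.
Qed.

(** The proof that [A] is a sigma-subalgebra is an argument so that the measure
    structure below can be found by unification. *)
Definition sub_measure of sub_sigma_algebra_of A := fun B : set TA => mu B.

Local Notation muA := (sub_measure hA).

Let sub_measure0 : muA set0 = 0. Proof. exact: measure0. Qed.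

Let sub_measure_ge0 B : 0 <= muA B. Proof. exact: measure_ge0. Qed.

Let sub_measure_sigma_additive : semi_sigma_additive muA.
Proof.
move=> F mF tF mUF; apply: (@measure_semi_sigma_additive _ _ _ mu F) => //.
- by move=> i; apply: hA.2; rewrite -sub_sigma_measurableE.
- by apply: hA.2; rewrite -sub_sigma_measurableE.
Qed.

HB.instance Definition _ := isMeasure.Build _ _ _ muA
  sub_measure0 sub_measure_ge0 sub_measure_sigma_additive.

Lemma integral_sub_measure (g : T -> \bar R) B : A B ->
  A_measurable A g -> (forall x, 0 <= g x) ->
  \int[muA]_(x in B) g x = \int[mu]_(x in B) g x.
Proof.
move=> AB mg g0; have mB : measurable (B : set TA).
  by rewrite sub_sigma_measurableE.
rewrite [LHS]integral_mkcond [RHS]integral_mkcond.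
have mgB : measurable_fun [set: TA] (g \_ B).
  apply: (measurable_restrictT _ mB).1.
  exact: measurable_funTS.
have gB0 x : 0 <= (g \_ B) x by apply: erestrict_ge0.
have := @eq_integral_comp_mul _ _ _ TA T TA R muA mu idfun idfun
  (cst 1) (cst 1) (g \_ B) (@measurable_id _ TA setT) measurable_sub_sigma_id
  (measurable_cst _) (measurable_cst _) (fun=> lee01) (fun=> lee01) _ mgB gB0.
have mule_cst1 (h : T -> \bar R) : (fun x => h x * cst 1 x) = h.
  by apply/funext => x; rewrite /= mule1.
rewrite !mule_cst1.
apply => D mD; rewrite !integral_cst//.
by apply: hA.2; rewrite -sub_sigma_measurableE.
Qed.

(** The density [f] is measurable only for the large sigma-algebra; the
    derivative of this measure on the small one is the conditional expectation
    of [f]. *)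
Lemma ex_finite_density (f : T -> \bar R) :
  measurable_fun [set: T] f -> (forall x, 0 <= f x) -> \int[mu]_x f x < +oo ->
  exists m : {finite_measure set TA -> \bar R},
    forall B, m B = \int[mu]_(x in B) f x.
Proof.
move=> mf f0 intf; pose m (B : set TA) := \int[mu]_(x in B) f x.
have m0 : m set0 = 0 by rewrite /m integral_set0.
have m_ge0 B : 0 <= m B by rewrite /m; apply: integral_ge0.
have m_additive : semi_sigma_additive m.
  move=> F mF tF mUF; apply: (semi_sigma_additive_nng_induced mf f0) => //.
  - by move=> i; apply: hA.2; rewrite -sub_sigma_measurableE.
  - by apply: hA.2; rewrite -sub_sigma_measurableE.
have m_fin : fin_num_fun m.
  move=> B mB; rewrite ge0_fin_numE//; apply: le_lt_trans intf.
  apply: ge0_subset_integral => //; apply: hA.2.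
  by rewrite -sub_sigma_measurableE.
pose m_measure := isMeasure.Build _ _ _ m m0 m_ge0 m_additive.
pose m_pack : {measure set TA -> \bar R} := HB.pack m m_measure.
pose m_finite := @Measure_isFinite.Build _ TA R m_pack m_fin.
pose m_finite_pack : {finite_measure set TA -> \bar R} :=
  HB.pack m m_measure m_finite.
by exists m_finite_pack.
Qed.

Lemma ex_cond_exp_integrable (f : T -> \bar R) : sigma_finite_on mu A ->
  measurable_fun [set: T] f -> (forall x, 0 <= f x) -> \int[mu]_x f x < +oo ->
  exists g, is_cond_exp mu A f g.
Proof.
move=> hAfin mf f0 intf; have [m mE] := ex_finite_density mf f0 intf.
pose muA_sigma_finite := @Measure_isSigmaFinite.Build _ TA R muA hAfin.
pose mu' : {sigma_finite_measure set TA -> \bar R} :=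
  HB.pack muA muA_sigma_finite.
have m_mu : m `<< mu'.
  apply/null_content_dominatesP => B mB muB; rewrite mE.
  have {}mB : measurable (B : set T).
    by apply: hA.2; rewrite -sub_sigma_measurableE.
  by apply: null_set_integral => //; exact: measurable_funTS.
have [g [g0 _ ig mg]] := radon_nikodym_sigma_finite m_mu.
have Ag : A_measurable A g by exact: measurable_int ig.
exists g; split=> // B AB; rewrite -mE mg ?sub_sigma_measurableE//.
exact: integral_sub_measure.
Qed.

End sub_sigma_algebra.

(** * Existence and comparison of conditional expectations *)

Section conditional_expectation.
Context d (T : measurableType d) (R : realType).
Variables (mu : {measure set T -> \bar R}) (A : set (set T)).
Hypotheses (hA : sub_sigma_algebra_of A) (hAfin : sigma_finite_on mu A).
Local Notation TA := (g_sigma_algebraType A).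

Lemma ex_sigma_finite_nd : exists F : (set T)^nat,
  [/\ \bigcup_i F i = setT, nondecreasing_seq F &
      forall i, A (F i) /\ mu (F i) < +oo].
Proof.
have [F [UF ndF mF]] := (sigma_finiteP [set: TA] (sub_measure mu hA)).1 hAfin.
exists F; split => // i; have [mFi muFi] := mF i.
by rewrite -(sub_sigma_measurableE hA).
Qed.

Lemma nd_cover_bounded (F : (set T)^nat) (y : \bar R) x :
  \bigcup_i F i = setT -> nondecreasing_seq F -> 0 <= y -> y < +oo ->
  exists n, F n x /\ y <= n%:R%:E.
Proof.
move=> UF ndF y0 yoo; have [i _ Fix] : (\bigcup_i F i) x by rewrite UF.
exists (maxn i (Num.bound (fine y))); split.
  by have /subsetPset := ndF _ _ (leq_maxl i (Num.bound (fine y))); apply.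
rewrite -(fineK (_ : y \is a fin_num)) ?ge0_fin_numE// lee_fin.
apply: (@le_trans _ _ (Num.bound (fine y))%:R).
  by apply/ltW/archi_boundP; rewrite fine_ge0.
by rewrite ler_nat leq_maxr.
Qed.

(** The measure [B |-> int_B f] need not be sigma-finite on [A], so
    Radon-Nikodym is applied to the pieces of [f] on a partition into sets of
    finite [f]-mass.  The pieces are measurable only for the large
    sigma-algebra, which is enough as they only cut [f], not [B]. *)
Lemma ex_cond_exp (f : T -> \bar R) : measurable_fun [set: T] f ->
  (forall x, 0 <= f x) -> (forall x, f x < +oo) ->
  exists g, is_cond_exp mu A f g.
Proof.
move=> mf f0 foo; have [F [UF ndF AF]] := ex_sigma_finite_nd.
have mF i : measurable (F i) by exact: hA.2 (AF i).1.
pose E n := F n `&` [set x | f x <= n%:R%:E].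
have mE n : measurable (E n).
  by apply: measurableI => //; rewrite -[X in measurable X]setTI;
    exact: emeasurable_fun_le.
pose Y := seqDU E.
have mY n : measurable (Y n).
  by apply: measurableD => //; apply: bigsetU_measurable.
have UY : \bigcup_n Y n = setT.
  rewrite -seqDU_bigcup_eq; apply/seteqP; split => // x _.
  have [n [Fnx fn]] := nd_cover_bounded x UF ndF (f0 x) (foo x).
  by exists n.
have intY n : \int[mu]_x (f \_ (Y n)) x < +oo.
  rewrite -integral_mkcond.
  apply: (@le_lt_trans _ _ (n%:R%:E * mu (E n))).
    apply: (@le_trans _ _ (\int[mu]_(x in E n) f x)).
      by apply: ge0_subset_integral => //;
        [exact: measurable_funTS|exact: subDsetl].
    under eq_integral do rewrite -[f _]gee0_abs//.
    apply: integral_le_bound => //; first exact: measurable_funTS.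
    by apply: aeW => x [_ /=]; rewrite gee0_abs.
  rewrite lte_mul_pinfty// ?lee_fin//.
  by apply: le_lt_trans (AF n).2; rewrite le_measure// ?inE//; exact: subIsetl.
have mfY n : measurable_fun [set: T] (f \_ (Y n)).
  by apply: (measurable_restrictT _ _).1 => //; exact: measurable_funTS.
have fY0 n x : 0 <= (f \_ (Y n)) x by apply: erestrict_ge0.
have /choice [g gE] n : exists g, is_cond_exp mu A (f \_ (Y n)) g.
  exact: ex_cond_exp_integrable.
have Ag n : A_measurable A (g n) by have [] := gE n.
have g0 n x : 0 <= g n x by have [] := gE n.
pose G x : \bar R := \sum_(n <oo) g n x; exists G; split.
- by apply: ge0_emeasurable_sum => // n _; exact: Ag.
- by move=> x; apply: nneseries_ge0.
move=> B AB; have mB := hA.2 _ AB.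
rewrite integral_nneseries//; last first.
  by move=> n; apply: measurable_funTS; exact: (measurable_A_measurable hA).
have BY : B = \bigcup_n (B `&` Y n) by rewrite -setI_bigcupr UY setIT.
rewrite [in LHS]BY ge0_integral_bigcup//.
- apply: eq_eseriesr => n _; rewrite integral_mkcondr.
  by have [_ _ ->] := gE n.
- by move=> n; exact: measurableI.
- exact: measurable_funTS.
- exact/trivIset_setIl/trivIset_seqDU.
Qed.

Lemma cond_expP (f : T -> \bar R) : measurable_fun [set: T] f ->
  (forall x, 0 <= f x) -> (forall x, f x < +oo) ->
  is_cond_exp mu A f (cond_exp mu A f).
Proof.
by move=> mf f0 foo; apply: xgetPex; exact: ex_cond_exp.
Qed.

(** On the part of [{h < g}] where [h <= n] inside a set of finite measure, both
    integrals are finite, so the strictly positive [g - h] has integral at most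
    0 there and the part is null. *)
Lemma ae_le_integral (g h : T -> \bar R) :
  A_measurable A g -> A_measurable A h ->
  (forall x, 0 <= g x) -> (forall x, 0 <= h x) ->
  (forall B, A B -> \int[mu]_(x in B) g x <= \int[mu]_(x in B) h x) ->
  {ae mu, forall x, g x <= h x}.
Proof.
move=> Ag Ah g0 h0 gh; have [F [UF ndF AF]] := ex_sigma_finite_nd.
have mg := measurable_A_measurable hA Ag.
have mh := measurable_A_measurable hA Ah.
pose B n := F n `&` ([set x | h x <= n%:R%:E] `&` [set x | h x < g x]).
have AB n : A (B n).
  rewrite -(sub_sigma_measurableE hA); apply: measurableI.
    by rewrite (sub_sigma_measurableE hA); exact: (AF n).1.
  apply: measurableI; rewrite -[X in measurable X]setTI.
    exact: (@emeasurable_fun_le _ TA).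
  exact: (@measurable_lte _ TA).
have mB n : measurable (B n) by exact: hA.2.
have inth n : \int[mu]_(x in B n) h x < +oo.
  apply: (@le_lt_trans _ _ (n%:R%:E * mu (B n))).
    under eq_integral do rewrite -[h _]gee0_abs//.
    apply: integral_le_bound => //; first exact: measurable_funTS.
    by apply: aeW => x [_ [/= ? _]]; rewrite gee0_abs.
  rewrite lte_mul_pinfty// ?lee_fin//.
  apply: le_lt_trans (AF n).2; rewrite le_measure// ?inE//.
    exact: hA.2 (AF n).1.
  exact: subIsetl.
have ge0_integrable (k : T -> \bar R) n : measurable_fun setT k ->
    (forall x, 0 <= k x) -> \int[mu]_(x in B n) k x < +oo ->
    mu.-integrable (B n) k.
  move=> mk k0 ik; apply/integrableP; split; first exact: measurable_funTS.
  by under eq_integral do rewrite gee0_abs//.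
have ih n := ge0_integrable h n mh h0 (inth n).
have ig n := ge0_integrable g n mg g0 (le_lt_trans (gh _ (AB n)) (inth n)).
have B_null n : {ae mu, forall x, ~ B n x}.
  have : \int[mu]_(x in B n) `|g x - h x| = 0.
    apply/eqP; rewrite eq_le integral_ge0 ?andbT//.
    rewrite (eq_integral (g \- h)); last first.
      move=> x /[!inE] -[_ [_ /= hgx]].
      by rewrite gee0_abs// ltW// sube_gt0.
    by rewrite integralB// sube_le0 gh.
  move/ae_eq_integral_abs => /(_ (mB n)).
  have mgh : measurable_fun (B n) (g \- h).
    by apply: measurable_funTS; exact: emeasurable_funB.
  move=> /(_ mgh); apply: filterS => x /= + Bx => /(_ Bx).
  by apply/eqP; rewrite gt_eqF// sube_gt0; case: Bx => _ [].
have := ae_foralln B_null; apply: filterS => x nB.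
rewrite leNgt; apply/negP => hgx.
have [n [Fnx hn]] := nd_cover_bounded x UF ndF (h0 x) (lt_le_trans hgx (leey _)).
by apply: (nB n).
Qed.

(** This is where a conditional expectation can be exchanged for the function
    under the integral. *)
Lemma cond_exp_mul (f g H : T -> \bar R) : measurable_fun [set: T] f ->
  (forall x, 0 <= f x) -> is_cond_exp mu A f g ->
  A_measurable A H -> (forall x, 0 <= H x) ->
  \int[mu]_x (H x * f x) = \int[mu]_x (H x * g x).
Proof.
move=> mf f0 [Ag g0 fg] AH H0.
apply: (@eq_integral_comp_mul _ _ _ T T TA R mu mu idfun idfun) => //.
- exact: measurable_sub_sigma_id.
- exact: measurable_sub_sigma_id.
- exact: (measurable_A_measurable hA).
- by move=> B mB; apply: fg; rewrite -(sub_sigma_measurableE hA).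
Qed.

End conditional_expectation.

(** * Conditional Hoelder inequality *)

Section young_optimization.
Context (R : realType) (p q : R).
Hypotheses (hp : (1 < p)%R) (hq : (1 < q)%R) (hpq : (p^-1 + q^-1 = 1)%R).
Local Open Scope ring_scope.

Let p0 : 0 < p. Proof. exact: lt_trans hp. Qed.
Let q0 : 0 < q. Proof. exact: lt_trans hq. Qed.

(** The right-hand side of the hypothesis is minimal at
    [t = (b/a)^(1/(p q))], where it equals the right-hand side of the
    conclusion; when [a] or [b] vanishes the infimum 0 is only approached. *)
Lemma young_le (a b G : R) : 0 <= a -> 0 <= b ->
  (forall t, 0 < t -> G <= t `^ q * a / q + t `^ (- p) * b / p) ->
  G <= a `^ q^-1 * b `^ p^-1.
Proof.
rewrite le_eqVlt => /predU1P[<- b0 Gt|a0].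
  rewrite powR0 ?invr_neq0 ?gt_eqF// mul0r; apply/ler_addgt0Pl => e e0.
  rewrite addr0; move: b0; rewrite le_eqVlt => /predU1P[b0|b0].
    have := Gt 1 ltr01; rewrite -b0 !(mulr0, mul0r) addr0.
    by move=> /le_trans; apply; exact: ltW.
  (* the [t] for which the remaining term is exactly [e] *)
  have t0 : 0 < b / (p * e) by rewrite divr_gt0// mulr_gt0.
  have := Gt _ (powR_gt0 p^-1 t0); rewrite mulr0 mul0r add0r.
  rewrite -powRrM mulrN mulVf ?gt_eqF// powR_inv1 ?(ltW t0)// => /le_trans; apply.
  by rewrite le_eqVlt; apply/orP; left; apply/eqP; field; rewrite !gt_eqF.
rewrite le_eqVlt => /predU1P[<- Gt|b0 Gt].
  rewrite powR0 ?invr_neq0 ?gt_eqF// mulr0; apply/ler_addgt0Pl => e e0.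
  rewrite addr0.
  have t0 : 0 < q * e / a by rewrite divr_gt0// mulr_gt0.
  have := Gt _ (powR_gt0 q^-1 t0); rewrite mulr0 mul0r addr0.
  rewrite -powRrM mulVf ?gt_eqF// powRr1 ?(ltW t0)// => /le_trans; apply.
  by rewrite le_eqVlt; apply/orP; left; apply/eqP; field; rewrite !gt_eqF.
have ba0 : 0 < b / a by rewrite divr_gt0.
have pq0 : p * q != 0 by rewrite mulf_neq0// gt_eqF.
have split_powR (c : R) : 0 < c -> c = c `^ p^-1 * c `^ q^-1.
  by move=> c0; rewrite -powRD ?hpq ?powRr1 ?ltW// oner_eq0.
have := Gt _ (powR_gt0 (p * q)^-1 ba0); rewrite -!powRrM.
have -> : (p * q)^-1 * q = p^-1 by field; rewrite !gt_eqF.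
have -> : (p * q)^-1 * - p = - q^-1 by field; rewrite !gt_eqF.
have powR_div s : (b / a) `^ s = b `^ s / a `^ s.
  rewrite powRM ?invr_ge0 ?(ltW a0) ?(ltW b0)// -powR_inv1 ?(ltW a0)//.
  by rewrite -powRrM mulN1r powRN.
rewrite powRN !powR_div {2}(split_powR a a0) {3}(split_powR b b0).
move=> /le_trans; apply; rewrite le_eqVlt; apply/orP; left; apply/eqP.
have X0 := powR_gt0 p^-1 a0; have X'0 := powR_gt0 q^-1 a0.
have Y0 := powR_gt0 p^-1 b0; have Y'0 := powR_gt0 q^-1 b0.
transitivity (a `^ q^-1 * b `^ p^-1 * (p^-1 + q^-1)); last by rewrite hpq mulr1.
by field; rewrite !gt_eqF.
Qed.

(** Only countably many [t] may be used when each inequality holds almost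
    everywhere; continuity in [t] makes the rational ones sufficient. *)
Lemma young_le_rat (a b G : R) : 0 <= a -> 0 <= b ->
  (forall r : rat, 0 < (ratr r : R) ->
    G <= (ratr r) `^ q * a / q + (ratr r) `^ (- p) * b / p) ->
  G <= a `^ q^-1 * b `^ p^-1.
Proof.
move=> a0 b0 Gr; apply: young_le => // t t0; rewrite leNgt; apply/negP => tG.
have cpow s : {for t, continuous (fun t : R => t `^ s)}.
  apply: differentiable_continuous; apply/derivable1_diffP.
  by apply: derivable_powR; rewrite in_itv/= t0.
have : (fun t => t `^ q * a / q + t `^ (- p) * b / p) r @[r --> t] -->
    t `^ q * a / q + t `^ (- p) * b / p.
  by apply: cvgD; do 2 (apply: cvgMl; try exact: cpow).
move=> /cvgr_lt /(_ _ tG) /nbhs_ballP[e /= e0 te].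
have [r] : exists r, ratr r \in `]t, (t + e)[ by apply: rat_in_itvoo; rewrite ltrDl.
rewrite in_itv/= => /andP[tr rte].
have := te (ratr r); rewrite /= /ball/= distrC gtr0_norm ?subr_gt0// ltrBlDl.
move=> /(_ rte); rewrite ltNge => /negP; apply; apply: Gr.
exact: lt_trans tr.
Qed.

End young_optimization.

Lemma ae_forall_countable d (T : measurableType d) (R : realType)
    (mu : {measure set T -> \bar R}) (I : countType) (P : I -> T -> Prop) :
  (forall i, {ae mu, forall x, P i x}) -> {ae mu, forall x, forall i, P i x}.
Proof.
move=> aeP.
have : {ae mu, forall x, forall n, oapp (P ^~ x) True (unpickle n)}.
  by apply: ae_foralln => n; case: (unpickle n) => [i|] //=; exact: aeW.
by apply: filterS => x Px i; have := Px (pickle i); rewrite pickleK.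
Qed.

Section conditional_hoelder.
Context d (T : measurableType d) (R : realType).
Variables (mu : {measure set T -> \bar R}) (A : set (set T)).
Hypotheses (hA : sub_sigma_algebra_of A) (hAfin : sigma_finite_on mu A).

Lemma cond_exp_le_lin (f f1 f2 g g1 g2 : T -> \bar R) (a b : R) :
  (0 <= a)%R -> (0 <= b)%R ->
  measurable_fun [set: T] f -> measurable_fun [set: T] f1 ->
  measurable_fun [set: T] f2 -> (forall x, 0 <= f x) -> (forall x, 0 <= f1 x) ->
  (forall x, 0 <= f2 x) -> is_cond_exp mu A f g -> is_cond_exp mu A f1 g1 ->
  is_cond_exp mu A f2 g2 -> (forall x, f x <= a%:E * f1 x + b%:E * f2 x) ->
  {ae mu, forall x, g x <= a%:E * g1 x + b%:E * g2 x}.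
Proof.
move=> a0 b0 mf mf1 mf2 f0 f10 f20 [Ag g0 fg] [Ag1 g10 fg1] [Ag2 g20 fg2] fle.
have int_lin (h1 h2 : T -> \bar R) B : A B ->
    measurable_fun [set: T] h1 -> measurable_fun [set: T] h2 ->
    (forall x, 0 <= h1 x) -> (forall x, 0 <= h2 x) ->
    \int[mu]_(x in B) (a%:E * h1 x + b%:E * h2 x) =
    a%:E * \int[mu]_(x in B) h1 x + b%:E * \int[mu]_(x in B) h2 x.
  move=> AB mh1 mh2 h10 h20; have mB := hA.2 _ AB.
  rewrite ge0_integralD//.
  - by rewrite !ge0_integralZl_EFin//; exact: measurable_funTS.
  - by move=> x _; rewrite mule_ge0.
  - by apply: measurable_funTS; exact: measurable_funeM.
  - by move=> x _; rewrite mule_ge0.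
  - by apply: measurable_funTS; exact: measurable_funeM.
apply: (ae_le_integral hA hAfin) => //.
- by apply: emeasurable_funD; exact: measurable_funeM.
- by move=> x; rewrite adde_ge0// mule_ge0.
move=> B AB; have mB := hA.2 _ AB.
rewrite int_lin//; [|exact: (measurable_A_measurable hA)..].
rewrite -fg// -fg1// -fg2// -int_lin//; apply: ge0_le_integral => //.
- exact: measurable_funTS.
- by apply: measurable_funTS; apply: emeasurable_funD; exact: measurable_funeM.
Qed.

Lemma cond_exp_le (f1 f2 g1 g2 : T -> \bar R) :
  measurable_fun [set: T] f1 -> measurable_fun [set: T] f2 ->
  (forall x, 0 <= f1 x) -> is_cond_exp mu A f1 g1 -> is_cond_exp mu A f2 g2 ->
  (forall x, f1 x <= f2 x) -> {ae mu, forall x, g1 x <= g2 x}.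
Proof.
move=> mf1 mf2 f10 [Ag1 g10 fg1] [Ag2 g20 fg2] f12.
apply: (ae_le_integral hA hAfin) => // B AB; have mB := hA.2 _ AB.
by rewrite -fg1// -fg2//; apply: ge0_le_integral => //; exact: measurable_funTS.
Qed.

(** Young's inequality is applied to [t h] and [f / t] and conditioned for each
    rational [t]; [young_le_rat] then optimises at each point outside one null
    set. *)
Lemma conditional_hoelder (p q : R) (f h : T -> R) (G F H : T -> \bar R) :
  (1 < p)%R -> (1 < q)%R -> (p^-1 + q^-1 = 1)%R ->
  measurable_fun [set: T] f -> measurable_fun [set: T] h ->
  (forall x, 0 <= f x)%R -> (forall x, 0 <= h x)%R ->
  is_cond_exp mu A (fun x => (h x * f x)%:E) G ->
  is_cond_exp mu A (fun x => (f x `^ p)%:E) F ->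
  is_cond_exp mu A (fun x => (h x `^ q)%:E) H ->
  {ae mu, forall x, F x < +oo} -> {ae mu, forall x, H x < +oo} ->
  {ae mu, forall x, G x <= H x `^ q^-1 * F x `^ p^-1}.
Proof.
move=> hp hq hpq mf mh f0 h0 EG EF EH Foo Hoo.
have p0 : (0 < p)%R by exact: lt_trans hp.
have q0 : (0 < q)%R by exact: lt_trans hq.
have mpow (k : T -> R) s : measurable_fun [set: T] k ->
    measurable_fun [set: T] (fun x => (k x `^ s)%:E).
  move=> mk; apply/measurable_EFinP.
  exact: (measurableT_comp (measurable_powR s)).
have young_ae : {ae mu, forall x, forall r : rat, (0 < ratr r :> R)%R ->
    G x <= (ratr r `^ q / q)%:E * H x + (ratr r `^ (- p) / p)%:E * F x}.
  apply: ae_forall_countable => r.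
  have [r0|r0] := boolP (0 < ratr r :> R)%R; last by apply: aeW.
  move: (ratr r : R) r0 => t t0.
  have c0 s s' : (0 < s)%R -> (0 <= t `^ s' / s)%R.
    by move=> s0; rewrite divr_ge0 ?powR_ge0 ?ltW.
  have := cond_exp_le_lin (c0 q q q0) (c0 p (- p)%R p0)
    (_ : measurable_fun _ (fun x => (h x * f x)%:E))
    (mpow h q mh) (mpow f p mf) _ _ _ EG EH EF.
  have mhf : measurable_fun setT (fun x => (h x * f x)%:E).
    by apply/measurable_EFinP; exact: measurable_funM.
  move=> /(_ mhf) ae_le.
  have : {ae mu, forall x, G x <= (t `^ q / q)%:E * H x + (t `^ (- p) / p)%:E * F x}.
    apply: ae_le => x; [by rewrite lee_fin mulr_ge0|by rewrite lee_fin powR_ge0..|].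
    rewrite -!EFinM -EFinD lee_fin.
    have := @conjugate_powR R (t * h x)%R (f x / t)%R q p.
    rewrite mulr_ge0 ?divr_ge0 ?(ltW t0)// => /(_ isT isT q0 p0).
    rewrite addrC hpq => /(_ erefl).
    have -> : (t * h x * (f x / t) = h x * f x)%R by field; rewrite gt_eqF.
    move=> /le_trans; apply.
    rewrite !powRM ?invr_ge0 ?(ltW t0)// -powR_inv1 ?(ltW t0)// -powRrM mulN1r.
    by rewrite le_eqVlt; apply/orP; left; apply/eqP; ring.
  by apply: filterS => x + _.
have [[[_ G0 _] [_ F0 _]] [_ H0 _]] := ((EG, EF), EH).
move: young_ae Foo Hoo; apply: filterS3 => x; have := (G0 x, F0 x, H0 x).
move=> [[]]; case: (F x) => [Fx||]//; case: (H x) => [Hx||]//.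
case: (G x) => [Gx||]//; last first.
  by move=> _ _ _ /(_ 1%Q); rewrite rmorph1 ltr01 => /(_ isT).
rewrite !poweR_EFin -EFinM !lee_fin => _ Fx0 Hx0 young _ _.
apply: young_le_rat => // r r0; have := young r r0.
rewrite -!EFinM -EFinD lee_fin => /le_trans; apply.
by rewrite le_eqVlt; apply/orP; left; apply/eqP; ring.
Qed.

End conditional_hoelder.

(** * Complex-valued functions *)

Section complex_modulus.
Context (R : realType).
Local Open Scope ring_scope.
Implicit Type z : R[i].

Lemma normc_ge0 z : 0 <= Normc.normc z.
Proof. by case: z => a b; exact: sqrtr_ge0. Qed.

Lemma normc_powR z : Normc.normc z =
  ((complex.Re z) ^+ 2 + (complex.Im z) ^+ 2) `^ 2^-1.
Proof. by case: z => a b; rewrite powR12_sqrt// addr_ge0// sqr_ge0. Qed.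

Lemma normc_ge_normRe z : `|complex.Re z| <= Normc.normc z.
Proof.
case: z => a b /=; rewrite -[leLHS]sqrtr_sqr; apply: ler_wsqrtr.
by rewrite lerDl sqr_ge0.
Qed.

Lemma normc_ge_normIm z : `|complex.Im z| <= Normc.normc z.
Proof.
case: z => a b /=; rewrite -[leLHS]sqrtr_sqr; apply: ler_wsqrtr.
by rewrite lerDr sqr_ge0.
Qed.

Lemma normc_le_normD (a b : R) : Normc.normc (Complex a b) <= `|a| + `|b|.
Proof.
rewrite -[leRHS]ger0_norm ?addr_ge0// -[leRHS]sqrtr_sqr; apply: ler_wsqrtr.
rewrite sqrrD -(real_normK (num_real a)) -(real_normK (num_real b)).
by rewrite lerD2r lerDl mulrn_wge0// mulr_ge0.
Qed.

End complex_modulus.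

Section complex_measurable.
Context d (T : measurableType d) (R : realType).
Implicit Types f g : T -> R[i].

Lemma measurable_normc f : cmeasurable f ->
  measurable_fun [set: T] (fun x => Normc.normc (f x)).
Proof.
move=> [mRe mIm]; under eq_fun do rewrite normc_powR.
apply: (measurableT_comp (measurable_powR _)).
by apply: measurable_funD; exact: measurable_funX.
Qed.

Lemma measurable_cabs_powR f (r : R) : cmeasurable f ->
  measurable_fun [set: T] (fun x => cabs f x `^ r).
Proof.
move=> /measurable_normc mf; apply/measurable_EFinP.
exact: (measurableT_comp (measurable_powR r)).
Qed.

Lemma cabs_ge0 f x : 0 <= cabs f x.
Proof. by rewrite lee_fin normc_ge0. Qed.

Lemma cabsM f g x : cabs (fun y => f y * g y)%R x = cabs f x * cabs g x.
Proof. by rewrite /cabs Normc.normcM. Qed.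

Lemma cmeasurableM f g : cmeasurable f -> cmeasurable g ->
  cmeasurable (fun x => f x * g x)%R.
Proof.
move=> [fRe fIm] [gRe gIm]; split.
  have -> : (fun x => complex.Re (f x * g x)%R) = (fun x =>
      complex.Re (f x) * complex.Re (g x) - complex.Im (f x) * complex.Im (g x))%R.
    by apply/funext => x; case: (f x); case: (g x).
  by apply: measurable_funB; exact: measurable_funM.
have -> : (fun x => complex.Im (f x * g x)%R) = (fun x =>
    complex.Re (f x) * complex.Im (g x) + complex.Im (f x) * complex.Re (g x))%R.
  by apply/funext => x; case: (f x); case: (g x).
by apply: measurable_funD; exact: measurable_funM.
Qed.

Lemma cmeasurable_if (b : T -> bool) f : measurable_fun [set: T] b ->
  cmeasurable f -> cmeasurable (fun x => if b x then f x else 0%R).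
Proof.
move=> mb [fRe fIm]; split.
  have -> : (fun x => complex.Re (if b x then f x else 0%R)) =
      (fun x => if b x then complex.Re (f x) else 0%R).
    by apply/funext => x; case: (b x).
  exact: measurable_fun_ifT.
have -> : (fun x => complex.Im (if b x then f x else 0%R)) =
    (fun x => if b x then complex.Im (f x) else 0%R).
  by apply/funext => x; case: (b x).
exact: measurable_fun_ifT.
Qed.

Lemma cLpE (mu : {measure set T -> \bar R}) (p : R) f : (0 < p)%R ->
  cLp mu p f <-> cmeasurable f /\ \int[mu]_x (cabs f x `^ p) < +oo.
Proof.
move=> p0; have p1 : (p^-1 != 0)%R by rewrite invr_neq0// gt_eqF.
rewrite /cLp/= unlock; under eq_integral do rewrite gee0_abs ?cabs_ge0//.
by split=> -[mf fp]; split=> //; [exact: lty_poweRy fp|exact: poweR_lty].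
Qed.

End complex_measurable.

Section complex_conditional_expectation.
Context d (T : measurableType d) (R : realType).
Variables (mu : {measure set T -> \bar R}) (A : set (set T)).
Hypotheses (hA : sub_sigma_algebra_of A) (hAfin : sigma_finite_on mu A).

Lemma is_cond_exp_cabs (f : T -> R[i]) : cmeasurable f ->
  is_cond_exp mu A (cabs f) (cond_exp mu A (cabs f)).
Proof.
move=> mf; apply: (cond_expP hA hAfin).
- by apply/measurable_EFinP; exact: measurable_normc.
- exact: cabs_ge0.
- by move=> x; rewrite ltry.
Qed.

Lemma is_cond_moment (r : R) (f : T -> R[i]) : cmeasurable f ->
  is_cond_exp mu A (fun x => cabs f x `^ r) (cond_moment mu A r f).
Proof.
move=> mf; apply: (cond_expP hA hAfin).
- exact: measurable_cabs_powR.
- by move=> x; rewrite poweR_ge0.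
- by move=> x; rewrite poweR_lty// ltry.
Qed.

Lemma is_cond_exp_funepos (f : T -> R) : measurable_fun [set: T] f ->
  is_cond_exp mu A (EFin \o f)^\+ (cond_exp mu A (EFin \o f)^\+).
Proof.
move=> mf; apply: (cond_expP hA hAfin).
- by apply: measurable_funepos; exact/measurable_EFinP.
- exact: funepos_ge0.
- by move=> x; rewrite funeposE /maxe; case: ifP => _; rewrite ltry.
Qed.

Lemma is_cond_exp_funeneg (f : T -> R) : measurable_fun [set: T] f ->
  is_cond_exp mu A (EFin \o f)^\- (cond_exp mu A (EFin \o f)^\-).
Proof.
move=> mf; apply: (cond_expP hA hAfin).
- by apply: measurable_funeneg; exact/measurable_EFinP.
- exact: funeneg_ge0.
- by move=> x; rewrite funenegE /maxe; case: ifP => _; rewrite ltry.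
Qed.

Lemma measurable_cond_expR (f : T -> R) : measurable_fun [set: T] f ->
  measurable_fun [set: T] (cond_expR mu A f).
Proof.
move=> mf; have [Ap _ _] := is_cond_exp_funepos mf.
have [An _ _] := is_cond_exp_funeneg mf.
by apply: measurable_funB; apply: (measurableT_comp (fine_measurable measurableT));
  exact: (measurable_A_measurable hA).
Qed.

Lemma cmeasurable_cond_expC (f : T -> R[i]) : cmeasurable f ->
  cmeasurable (cond_expC mu A f).
Proof. by move=> [mRe mIm]; split; exact: measurable_cond_expR. Qed.

(** The expectations of the positive and negative parts both lie between 0
    and [G], hence so does the absolute value of their difference. *)
Lemma ae_cond_expR_le (f : T -> R) (h G : T -> \bar R) :
  measurable_fun [set: T] f -> measurable_fun [set: T] h ->
  (forall x, `|f x|%:E <= h x) -> is_cond_exp mu A h G ->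
  {ae mu, forall x, `|cond_expR mu A f x|%:E <= G x}.
Proof.
move=> mf mh fh EG; have [Ep En] := (is_cond_exp_funepos mf, is_cond_exp_funeneg mf).
have mEf : measurable_fun [set: T] (EFin \o f) by exact/measurable_EFinP.
have ple : {ae mu, forall x, cond_exp mu A (EFin \o f)^\+ x <= G x}.
  apply: (cond_exp_le hA hAfin _ _ _ Ep EG) => //; first exact: measurable_funepos.
  move=> x; apply: le_trans (fh x); rewrite funeposE ge_max/= !lee_fin.
  by rewrite ler_norm normr_ge0.
have nle : {ae mu, forall x, cond_exp mu A (EFin \o f)^\- x <= G x}.
  apply: (cond_exp_le hA hAfin _ _ _ En EG) => //; first exact: measurable_funeneg.
  move=> x; apply: le_trans (fh x); rewrite funenegE ge_max/= !lee_fin.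
  by rewrite -normrN ler_norm normr_ge0.
have [[[_ p0 _] [_ n0 _]] [_ G0 _]] := ((Ep, En), EG).
move: ple nle; apply: filterS2 => x; rewrite /cond_expR.
have := (p0 x, n0 x).
case: (cond_exp _ _ _^\+ x) => [a||] [] //; case: (cond_exp _ _ _^\- x) => [b||] //;
  case: (G x) => [g||] //; rewrite ?leey//= ?lee_fin => a0 b0 ag bg.
by rewrite ler_norml; lra.
Qed.

(** The factor 2 is the price of treating the real and imaginary parts
    separately; the sharp constant is 1. *)
Lemma ae_cond_expC_le (f : T -> R[i]) : cmeasurable f ->
  {ae mu, forall x,
    cabs (cond_expC mu A f) x <= 2%:E * cond_exp mu A (cabs f) x}.
Proof.
move=> mf; have EG := is_cond_exp_cabs mf; have [_ G0 _] := EG.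
have mG : measurable_fun [set: T] (cabs f).
  by apply/measurable_EFinP; exact: measurable_normc.
have Re_le := ae_cond_expR_le mf.1 mG (fun x => normc_ge_normRe (f x)) EG.
have Im_le := ae_cond_expR_le mf.2 mG (fun x => normc_ge_normIm (f x)) EG.
move: Re_le Im_le; apply: filterS2 => x Rex Imx.
rewrite mule_natl mule2n; apply: le_trans (leeD Rex Imx).
by rewrite -EFinD lee_fin normc_le_normD.
Qed.

End complex_conditional_expectation.

(** * Density of a weighted Lp space *)

Section weighted_Lp_dense.
Context d (T : measurableType d) (R : realType).
Variables (mu nu : {measure set T -> \bar R}) (J : T -> \bar R) (p : R).
Hypotheses (p0 : (0 < p)%R) (mJ : measurable_fun [set: T] J)
  (J0 : forall x, 0 <= J x)
  (nuJ : forall S, measurable S -> nu S = \int[mu]_(x in S) J x).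

Lemma integral_density (h : T -> \bar R) : measurable_fun [set: T] h ->
  (forall x, 0 <= h x) -> \int[nu]_x h x = \int[mu]_x (h x * J x).
Proof.
move=> mh h0; have := @eq_integral_comp_mul _ _ _ T T T R nu mu idfun idfun
  (cst 1) J h (@measurable_id _ T setT) (@measurable_id _ T setT)
  (measurable_cst _) mJ (fun=> lee01) J0.
have -> : (fun x => h (idfun x) * cst 1 x) = h.
  by apply/funext => x; rewrite /= mule1.
apply => // B mB; rewrite -[RHS](nuJ mB).
by rewrite -[RHS]mul1e; exact: integral_cst.
Qed.

(** The approximant is [f] cut off to [{J <= n}], where [nu] is at most [n mu];
    the rest of [f] tends to 0 by dominated convergence as [J] is finite almost
    everywhere. *)
Lemma cLp_density_approx (f : T -> R[i]) (e : R) :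
  {ae mu, forall x, J x < +oo} -> cLp mu p f -> (0 < e)%R ->
  exists2 g, cLp nu p g &
    'N[mu]_p%:E[cabs (fun x => f x - g x)%R] < e%:E.
Proof.
move=> Joo /(cLpE _ _ p0)[mf intf] e0.
pose b n x := J x <= n%:R%:E.
pose g n x := if b n x then f x else 0%R.
pose K x := cabs f x `^ p.
have mK : measurable_fun [set: T] K by exact: measurable_cabs_powR.
have K0 x : 0 <= K x by exact: poweR_ge0.
have Koo : mu.-integrable [set: T] K.
  by apply/integrableP; split=> //; under eq_integral do rewrite gee0_abs//.
have mb n : measurable_fun [set: T] (b n) by exact: measurable_fun_lee.
have mg n : cmeasurable (g n) by exact: cmeasurable_if.
have cabs0 : Normc.normc (0 : R[i])%R = 0%R by exact: Normc.normc0.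
have p_neq0 : p != 0%R by rewrite gt_eqF.
have gE n x : cabs (g n) x `^ p = if b n x then K x else 0.
  by rewrite /g/cabs; case: (b n x) => //; rewrite cabs0 poweR0r.
have fgE n x : cabs (fun y => f y - g n y)%R x `^ p = if b n x then 0 else K x.
  by rewrite /g/cabs; case: (b n x); rewrite ?subrr ?cabs0 ?poweR0r// subr0.
have cvg0 : \int[mu]_x (if b n x then 0 else K x) @[n --> \oo] --> 0.
  have [|||||_ _] := @dominated_convergence _ T R mu setT measurableT
    (fun n x => if b n x then 0 else K x) (cst 0) K => //.
  - by move=> n; exact: measurable_fun_ifT.
  - move: Joo; apply: filterS => x Jx _; apply: cvg_near_cst.
    have Jfin : J x \is a fin_num by rewrite ge0_fin_numE.
    near=> n; rewrite /b ifT//.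
    rewrite -(fineK Jfin) lee_fin.
    near: n; exact: nbhs_infty_ger.
  - by apply: aeW => x n _; case: (b n x); rewrite ?abse0// gee0_abs.
  - by rewrite integral0.
(* halving [e] turns the weak inequality kept by the p-th root into a strict one *)
have ep0 : 0 < ((e / 2) `^ p)%:E by rewrite lte_fin powR_gt0// divr_gt0.
have [n _ /(_ n (leqnn n)) /= int_lt] := cvg0 _ (open_ereal_lt' ep0).
exists (g n).
  apply/(cLpE _ _ p0); split=> //; rewrite integral_density; last 2 first.
  - exact: measurable_cabs_powR.
  - by move=> x; exact: poweR_ge0.
  apply: (@le_lt_trans _ _ (\int[mu]_x (n%:R%:E * K x))).
    apply: ge0_le_integral => //.
    - by move=> x _; rewrite mule_ge0// poweR_ge0.
    - by apply: emeasurable_funM => //; exact: measurable_cabs_powR.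
    - exact: measurable_funeM.
    - move=> x _; rewrite gE; case: ifPn => [bx|_]; last by rewrite mul0e mule_ge0.
      by rewrite muleC lee_wpmul2r.
  by rewrite ge0_integralZl_EFin// lte_mul_pinfty// lee_fin.
rewrite unlock; under eq_integral do rewrite gee0_abs ?cabs_ge0// fgE.
apply: (@le_lt_trans _ _ (e / 2)%:E); last first.
  by rewrite lte_fin ltr_pdivrMr// ltr_pMr// ltr1n.
have -> : (e / 2)%:E = ((e / 2) `^ p)%:E `^ p^-1.
  by rewrite poweR_EFin -powRrM divff// powRr1// divr_ge0// ltW.
apply: gt0_ler_poweR; rewrite ?invr_ge0 ?(ltW p0) ?in_itv/= ?leey ?andbT//.
- by apply: integral_ge0 => x _; case: ifP.
- exact: ltW.
- exact: ltW.
Unshelve. all: by end_near. Qed.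

End weighted_Lp_dense.

Lemma cLp_closure_dense d (T : measurableType d) (R : realType)
    (mu : {measure set T -> \bar R}) (p : R) (S S' : set (T -> R[i])) :
  S `<=` S' ->
  (forall f e, cLp mu p f -> (0 < e)%R -> exists2 g, S g &
    'N[mu]_p%:E[cabs (fun x => f x - g x)%R] < e%:E) ->
  cLp_closure mu p S' = cLp mu p.
Proof.
move=> SS' dense; apply/seteqP; split => [f []//|f fp]; split=> // e e0.
by have [g Sg fg] := dense f e fp e0; exists g => //; exact: SS'.
Qed.

(** Finiteness of the product alone would allow [0 * +oo]; determinacy excludes
    it. *)
Lemma poweR_mul_lty (R : realType) (x y : \bar R) (r s : R) :
  (0 < r)%R -> (0 < s)%R -> 0 <= x -> 0 <= y ->
  x `^ r *? y `^ s -> x `^ r * y `^ s < +oo -> x < +oo /\ y < +oo.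
Proof.
move=> r0 s0; have [r1 s1] : (r != 0 /\ s != 0)%R by rewrite !gt_eqF.
case: x => [x||]//; case: y => [y||]//; rewrite ?lee_fin => x0 y0.
- by rewrite !ltry.
- rewrite poweRyr// poweR_EFin /mule_def => xr.
  by rewrite gt0_muley// lte_fin lt_neqAle eq_sym xr powR_ge0.
- rewrite poweRyr// poweR_EFin /mule_def => yr.
  by rewrite gt0_mulye// lte_fin lt_neqAle eq_sym yr powR_ge0.
- by rewrite !poweRyr.
Qed.

(** * The weighted conditional type operator *)

Section wct.
Context d (T : measurableType d) (R : realType).
Variables (mu : {measure set T -> \bar R}) (A : set (set T)).
Hypotheses (hA : sub_sigma_algebra_of A) (hAfin : sigma_finite_on mu A).
Variables (u w : T -> R[i]) (p q : R).
Hypotheses (cmu : cmeasurable u) (cmw : cmeasurable w).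
Hypotheses (hp : (1 < p)%R) (hq : (1 < q)%R) (hpq : (p^-1 + q^-1 = 1)%R).

Let p0 : (0 < p)%R. Proof. exact: lt_trans hp. Qed.
Let q0 : (0 < q)%R. Proof. exact: lt_trans hq. Qed.

Local Notation W := (cond_moment mu A p w).
Local Notation U := (cond_moment mu A q u).
Local Notation J := (wct_J mu A p q w u).

Let W0 x : 0 <= W x. Proof. by have [_ + _] := is_cond_moment hA hAfin p cmw. Qed.
Let U0 x : 0 <= U x. Proof. by have [_ + _] := is_cond_moment hA hAfin q cmu. Qed.

Lemma poweR_hoelder_bound (c : R) (a b : \bar R) : (0 <= c)%R -> 0 <= b ->
  (c%:E * (a `^ q^-1 * b `^ p^-1)) `^ p = (c `^ p)%:E * (a `^ (p / q) * b).
Proof.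
move=> c0 b0; rewrite poweRM ?lee_fin ?mule_ge0 ?poweR_ge0//.
rewrite poweRM ?poweR_ge0// -!poweRrM mulVf ?gt_eqF// (poweRe1 b0).
by rewrite (mulrC p).
Qed.

Lemma A_measurable_poweR (f : T -> \bar R) (r : R) : A_measurable A f ->
  A_measurable A (fun x => f x `^ r).
Proof.
move=> Af; rewrite /A_measurable.
exact: (measurableT_comp (measurable_poweR r) Af).
Qed.

Let AW : A_measurable A W. Proof. by have [] := is_cond_moment hA hAfin p cmw. Qed.
Let AU : A_measurable A U. Proof. by have [] := is_cond_moment hA hAfin q cmu. Qed.

Lemma wct_J_ge1 x : 1 <= J x.
Proof. by rewrite /wct_J leeDl// mule_ge0// poweR_ge0. Qed.

Lemma measurable_wct_J : measurable_fun [set: T] J.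
Proof.
have AUpq := A_measurable_poweR (p / q) AU.
apply: (measurable_A_measurable hA).
exact: (emeasurable_funD (measurable_cst _) (emeasurable_funM AW AUpq)).
Qed.

Hypothesis (Uoo : {ae mu, forall x, U x < +oo}).

(** [E(|f|^p)] is finite almost everywhere because its integral is that of
    [|f|^p]; conditional Hoelder then applies. *)
Lemma ae_cond_exp_mul_le (f : T -> R[i]) : cLp mu p f ->
  {ae mu, forall x, cond_exp mu A (cabs (fun y => u y * f y)%R) x <=
     U x `^ q^-1 * cond_moment mu A p f x `^ p^-1 /\
     cond_moment mu A p f x < +oo}.
Proof.
move=> /(cLpE _ _ p0)[mf intf].
have EF := is_cond_moment hA hAfin p mf; have [AF F0 KF] := EF.
have AT : A setT by rewrite -(sub_sigma_measurableE hA); exact: measurableT.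
have Foo : {ae mu, forall x, cond_moment mu A p f x < +oo}.
  have : mu.-integrable [set: T] (cond_moment mu A p f).
    apply/integrableP; split; first exact: (measurable_A_measurable hA).
    under eq_integral do rewrite gee0_abs//.
    by rewrite -(KF _ AT).
  move=> /integrable_ae - /(_ measurableT); apply: filterS => x /(_ I).
  by rewrite ge0_fin_numE.
have EG := is_cond_exp_cabs hA hAfin (cmeasurableM cmu mf).
have EU := is_cond_moment hA hAfin q cmu.
have cabs_uf : cabs (fun y => u y * f y)%R =
    (fun x => (Normc.normc (u x) * Normc.normc (f x))%:E).
  by apply/funext => x; rewrite cabsM.
rewrite cabs_uf in EG *.
have G_le := conditional_hoelder hA hAfin hp hq hpq (measurable_normc mf)
  (measurable_normc cmu) (fun=> normc_ge0 _) (fun=> normc_ge0 _)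
  EG EF EU Foo Uoo.
by move: Foo G_le; apply: filterS2.
Qed.

Lemma conditionable_mul (f : T -> R[i]) : cLp mu p f ->
  conditionable mu A (fun x => u x * f x)%R.
Proof.
move=> fp; have [mf _] := (cLpE _ _ p0).1 fp.
split; first exact: cmeasurableM.
move: (ae_cond_exp_mul_le fp) Uoo; apply: filterS2 => x [G_le Foo] Ux.
apply: le_lt_trans G_le _; rewrite lte_mul_pinfty ?poweR_ge0 ?poweR_lty//.
by rewrite ge0_fin_numE ?poweR_ge0// poweR_lty.
Qed.

(** The key estimate: after conditional Hoelder, [|w|^p] and [E(|f|^p)] trade
    places with their partners [E(|w|^p)] and [|f|^p], one at a time, because the
    rest of the integrand is [A]-measurable each time. *)
Lemma integral_wct_le (f : T -> R[i]) : cLp mu p f ->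
  \int[mu]_x (cabs (wct mu A w u f) x `^ p) <=
  (2 `^ p)%:E * \int[mu]_x (cabs f x `^ p * J x).
Proof.
move=> fp; have [mf intf] := (cLpE _ _ p0).1 fp.
have muf := cmeasurableM cmu mf.
have EF := is_cond_moment hA hAfin p mf; have [AF F0 _] := EF.
have EW := is_cond_moment hA hAfin p cmw.
set F := cond_moment mu A p f in EF AF F0.
have AUpq : A_measurable A (fun x => U x `^ (p / q)) by exact: A_measurable_poweR.
have mUpq := measurable_A_measurable hA AUpq.
have mF := measurable_A_measurable hA AF.
have mW := measurable_A_measurable hA AW.
have Upq0 x : 0 <= U x `^ (p / q) by exact: poweR_ge0.
have mwp := measurable_cabs_powR p cmw; have mfp := measurable_cabs_powR p mf.
have UF0 x : 0 <= U x `^ (p / q) * F x by exact: (mule_ge0 (Upq0 x) (F0 x)).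
have UFw0 x : 0 <= U x `^ (p / q) * F x * cabs w x `^ p.
  exact: (mule_ge0 (UF0 x) (poweR_ge0 _ _)).
have mUF := emeasurable_funM mUpq mF.
have mUFw := emeasurable_funM mUF mwp.
have twop_ge0 : (0 <= 2 `^ p :> R)%R by exact: powR_ge0.
apply: (@le_trans _ _
    (\int[mu]_x ((2 `^ p)%:E * ((U x `^ (p / q) * F x) * cabs w x `^ p)))).
  apply: ae_ge0_le_integral => //.
  - by move=> x _; exact: poweR_ge0.
  - apply: measurable_cabs_powR; apply: cmeasurableM => //.
    exact: (cmeasurable_cond_expC hA hAfin).
  - by move=> x _; exact: mule_ge0.
  - exact: measurable_funeM.
  move: (ae_cond_expC_le hA hAfin muf) (ae_cond_exp_mul_le fp).
  apply: filterS2 => x E_le [G_le _] _.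
  have UF_ge0 : 0 <= U x `^ q^-1 * F x `^ p^-1.
    by apply: mule_ge0; exact: poweR_ge0.
  have {}E_le : cabs (cond_expC mu A (fun y => u y * f y)%R) x <=
      2%:E * (U x `^ q^-1 * F x `^ p^-1).
    by apply: le_trans E_le _; rewrite lee_wpmul2l.
  rewrite cabsM poweRM ?cabs_ge0// muleC muleA lee_wpmul2r ?poweR_ge0//.
  rewrite -(poweR_hoelder_bound _ (ler0n R 2) (F0 x)).
  apply: gt0_ler_poweR => //; first exact: ltW.
    by rewrite in_itv/= leey cabs_ge0.
  by rewrite in_itv/= leey andbT mule_ge0.
rewrite (ge0_integralZl_EFin mu measurableT (fun x _ => UFw0 x) mUFw twop_ge0).
apply: lee_wpmul2l; first by rewrite lee_fin.
have fp0 x : 0 <= cabs f x `^ p by exact: poweR_ge0.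
have wp0 x : 0 <= cabs w x `^ p by exact: poweR_ge0.
rewrite (cond_exp_mul hA mwp wp0 EW (emeasurable_funM AUpq AF) UF0).
under eq_integral do rewrite muleAC.
have UW0 x : 0 <= U x `^ (p / q) * W x by exact: (mule_ge0 (Upq0 x) (W0 x)).
rewrite -(cond_exp_mul hA mfp fp0 EF (emeasurable_funM AUpq AW) UW0).
apply: ge0_le_integral; first exact: measurableT.
- by move=> x _; exact: (mule_ge0 (UW0 x) (fp0 x)).
- exact: (emeasurable_funM (emeasurable_funM mUpq mW) mfp).
- exact: (emeasurable_funM mfp measurable_wct_J).
move=> x _; rewrite [leLHS]muleC; apply: (lee_wpmul2l (fp0 x)).
rewrite [leLHS]muleC /wct_J.
by rewrite leeDr.
Qed.

End wct.

Theorem lemma2p2 (R : realType) (d : measure_display) (T : measurableType d)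
    (mu : {sigma_finite_measure set T -> \bar R}) (A : set (set T))
    (hA : sub_sigma_algebra_of A) (hAfin : sigma_finite_on mu A)
    (u w : T -> R[i])
    (hu : conditionable mu A u) (hw : conditionable mu A w)
    (p q : R) (hp : (1 < p)%R) (hq : (1 < q)%R) (hpq : (p^-1 + q^-1 = 1)%R)
    (hfin : {ae mu, forall x,
       (cond_moment mu A p w x `^ p^-1 *? cond_moment mu A q u x `^ q^-1) /\
       cond_moment mu A p w x `^ p^-1 * cond_moment mu A q u x `^ q^-1 < +oo})
    (nu : {measure set T -> \bar R})
    (hnu : forall S, measurable S ->
       nu S = \int[mu]_(x in S) wct_J mu A p q w u x) :
  [/\ [set t | wct_J mu A p q w u t != 0] = [set: T],
      cLp nu p `<=` wct_domain mu A p w u,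
      cLp_closure mu p (cLp nu p) = cLp mu p &
      cLp_closure mu p (wct_domain mu A p w u) = cLp mu p].
Proof.
have [[cmu _] [cmw _]] := (hu, hw).
have p0 : (0 < p)%R by exact: lt_trans hp.
have q0 : (0 < q)%R by exact: lt_trans hq.
have [_ W0 _] := is_cond_moment hA hAfin p cmw.
have [_ U0 _] := is_cond_moment hA hAfin q cmu.
have WUoo : {ae mu, forall x,
    cond_moment mu A p w x < +oo /\ cond_moment mu A q u x < +oo}.
  move: hfin; apply: filterS => x [WU_def WUx].
  by apply: poweR_mul_lty WU_def WUx => //; rewrite invr_gt0.
have Uoo : {ae mu, forall x, cond_moment mu A q u x < +oo}.
  by move: WUoo; apply: filterS => x [].
have Joo : {ae mu, forall x, wct_J mu A p q w u x < +oo}.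
  move: WUoo; apply: filterS => x [Wx Ux].
  apply: lte_add_pinfty; first by rewrite ltry.
  apply: lte_mul_pinfty; first exact: W0.
    rewrite (ge0_fin_numE (W0 x)); exact: Wx.
  exact: (poweR_lty _ Ux).
have J1 x : 1 <= wct_J mu A p q w u x by exact: (wct_J_ge1 hA hAfin).
have J0 x : 0 <= wct_J mu A p q w u x by exact: le_trans (J1 x).
have mJ : measurable_fun [set: T] (wct_J mu A p q w u).
  exact: (measurable_wct_J hA hAfin).
have nu_dom : cLp nu p `<=` wct_domain mu A p w u.
  move=> f /(cLpE _ _ p0)[mf]; have mfp := measurable_cabs_powR p mf.
  have fp0 x : 0 <= cabs f x `^ p by exact: poweR_ge0.
  rewrite (integral_density mJ J0 hnu mfp fp0) => fJ.
  have fp : cLp mu p f.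
    apply/(cLpE _ _ p0); split => //; apply: le_lt_trans fJ.
    apply: ge0_le_integral => //; first exact: emeasurable_funM.
    by move=> x _; rewrite lee_pemulr.
  split; first exact: fp.
    exact: (conditionable_mul hA hAfin cmu hp hq hpq Uoo fp).
  apply/(cLpE _ _ p0); split.
    apply: cmeasurableM => //; apply: (cmeasurable_cond_expC hA hAfin).
    exact: cmeasurableM.
  have := integral_wct_le hA hAfin cmu cmw hp hq hpq Uoo fp.
  by move=> /le_lt_trans; apply; rewrite lte_mul_pinfty// lee_fin powR_ge0.
have dense f e : cLp mu p f -> (0 < e)%R -> exists2 g, cLp nu p g &
    'N[mu]_p%:E[cabs (fun x => f x - g x)%R] < e%:E.
  by move=> fp e0; exact: (cLp_density_approx p0 mJ J0 hnu Joo fp e0).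
split.
- apply/seteqP; split => // x _ /=.
  by rewrite gt_eqF// (lt_le_trans _ (J1 x)).
- exact: nu_dom.
- exact: (cLp_closure_dense _ dense).
- exact: (cLp_closure_dense nu_dom dense).
Qed.
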